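(* Fix $E>0$ and $q_a<q_b$. For $\varepsilon>0$ suppose $q_\varepsilon\colon\mathbb{R}\to\mathbb{R}$ satisfies $$q_\varepsilon''(t)=-\frac1\varepsilon V'\!\left(\frac{q_\varepsilon(t)}{\varepsilon}\right),\quad t\in\mathbb{R},$$ with $q_\varepsilon'>0$, $q_\varepsilon(0)=q_a$, $q_\varepsilon(T_\varepsilon)=q_b$ and $$\frac12|q_\varepsilon'(t)|^2+V(q_\varepsilon(t)/\varepsilon)=E,\quad t\in\mathbb{R}.$$ Let $$t_\varepsilon(q)=\int_{q_a}^q\frac{1}{\sqrt{2\left(E-V(\gamma/\varepsilon)\right)}}\,d\gamma .$$ Then $t_\varepsilon\to\bar t$ uniformly (on $\mathbb{R}$) as $\varepsilon\to0$, where $\bar t(q)=\sigma(E)(q-q_a)$. Furthermore, $T_\varepsilon\to\bar T$ as $\varepsilon\to0$, where $\bar T=\sigma(E)(q_b-q_a)$.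
   Context: $V\in C^2(\mathbb{R})$ is $1$-periodic with $\max V=0$. For $E>0$, $$\sigma(E):=\int_0^1\frac{1}{\sqrt{2(E-V(\gamma))}}\,d\gamma.$$ The arrival time $T_\varepsilon$ is allowed to depend on $\varepsilon$. *)

(* Defs.v *)
From Stdlib Require Import Reals.
From Coquelicot Require Import Coquelicot.
Open Scope R_scope.

(* [ex_derive_n f 2] alone does not entail differentiability of [f], since
   [Derive] is total; hence every order up to 2 is required. *)
Definition C2 (f : R -> R) : Prop :=
  (forall (k : nat) (x : R), (k <= 2)%nat -> ex_derive_n f k x) /\
  (forall x : R, continuous (Derive_n f 2) x).

Definition periodic1 (f : R -> R) : Prop := forall x : R, f (x + 1) = f x.

Definition is_max (f : R -> R) (m : R) : Prop :=
  (forall x : R, f x <= m) /\ (exists x : R, f x = m).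

Definition effective_sigma (V : R -> R) (E : R) : R :=
  RInt (fun g => 1 / sqrt (2 * (E - V g))) 0 1.

(* [RInt] is oriented, so the formula is also the intended one for [q < qa]. *)
Definition t_eps (V : R -> R) (E qa eps q : R) : R :=
  RInt (fun g => 1 / sqrt (2 * (E - V (g / eps)))) qa q.

Definition t_bar (V : R -> R) (E qa q : R) : R := effective_sigma V E * (q - qa).

(* Differentiability of [q] is explicit because [Derive] is total. *)
Definition is_trajectory (V : R -> R) (E qa qb eps : R) (q : R -> R) (T : R)
  : Prop :=
  (forall t : R, ex_derive q t) /\
  (forall t : R, is_derive_n q 2 t (- (1 / eps) * Derive V (q t / eps))) /\
  (forall t : R, 0 < Derive q t) /\
  q 0 = qa /\
  q T = qb /\
  (forall t : R, 1 / 2 * Rabs (Derive q t) ^ 2 + V (q t / eps) = E).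

(* The neighbourhoods of [g] in [fct_UniformSpace] are generated by sup-type
   balls [{h | forall x, |h x - g x| < r}]: this is uniform convergence on the
   whole line as [eps] tends to 0 from the right. *)
Definition cvg_uniformly_at_0 (f : R -> R -> R) (g : R -> R) : Prop :=
  filterlim f (at_right 0)
    (@locally (fct_UniformSpace R R_UniformSpace) g).

(* Main.v *)
Require Import Defs.
From Stdlib Require Import Reals Lra.
From Coquelicot Require Import Coquelicot.
Open Scope R_scope.

(** Write [f g = 1 / sqrt (2 * (E - V g))], a positive continuous 1-periodic
    function, and [F x = RInt f 0 x].  The drift-corrected primitive
    [D x = F x - F 1 * x] is 1-periodic, and since [F] is monotone, [D] is
    bounded by [F 1], which is [effective_sigma V E].  Rescaling gives
    [t_eps q = eps * (F (q / eps) - F (qa / eps))], so that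
    [t_eps q - t_bar q = eps * (D (q / eps) - D (qa / eps))] is at most
    [2 * eps * F 1] in absolute value, uniformly in [q]
    ([rescaled_integral_error]).

    For the arrival time, conservation of energy and [q' > 0] say that
    [f (q t / eps) * q' t = 1]; hence [eps * F (q t / eps)] has derivative 1
    in [t], and [T_eps = t_eps qb] ([arrival_time_eq]).  The second limit is
    thus governed by the same error bound. *)

(** * Primitives of periodic functions *)

(** The primitive of [f] minus its mean linear growth over a unit period. *)
Definition drift_corrected (f : R -> R) (x : R) : R :=
  RInt f 0 x - RInt f 0 1 * x.

Lemma ex_RInt_cont (f : R -> R) (a b : R) :
  (forall x, continuous f x) -> ex_RInt f a b.
Proof. intros Hf; apply (ex_RInt_continuous (V := R_CompleteNormedModule)); auto. Qed.

Lemma is_derive_primitive (f : R -> R) (x : R) :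
  (forall y, continuous f y) -> is_derive (fun y => RInt f 0 y) x (f x).
Proof.
  intros Hf. apply (is_derive_RInt f (fun y => RInt f 0 y) 0 x); [|apply Hf].
  apply filter_forall; intros y; apply (RInt_correct f), ex_RInt_cont, Hf.
Qed.

Lemma periodic1_IZR (f : R -> R) : periodic1 f ->
  forall (z : Z) (x : R), f (x + IZR z) = f x.
Proof.
  intros Hp z. induction z as [|z IH|z IH] using Z.peano_ind; intros x.
  - now rewrite Rplus_0_r.
  - rewrite succ_IZR, <- Rplus_assoc, Hp. apply IH.
  - rewrite <- (IH x), <- (Hp (x + IZR (Z.pred z))). f_equal.
    unfold Z.pred. rewrite plus_IZR. simpl. ring.
Qed.

Lemma periodic1_bounded (f : R -> R) (M : R) : periodic1 f ->
  (forall x, 0 <= x <= 1 -> Rabs (f x) <= M) -> forall x, Rabs (f x) <= M.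
Proof.
  intros Hp HM x. rewrite <- (periodic1_IZR f Hp (- Int_part x) x).
  apply HM. rewrite opp_IZR. destruct (base_Int_part x). lra.
Qed.

Lemma drift_corrected_periodic (f : R -> R) :
  (forall x, continuous f x) -> periodic1 f -> periodic1 (drift_corrected f).
Proof.
  intros Hf Hp x. unfold drift_corrected.
  assert (Hshift : RInt f 1 (x + 1) = RInt f 0 x).
  { transitivity (RInt (fun y => scal 1 (f (1 * y + 1))) 0 x).
    - symmetry. replace (x + 1) with (1 * x + 1) by ring.
      replace (RInt f 1) with (RInt f (1 * 0 + 1)) by (f_equal; ring).
      apply (RInt_comp_lin f 1 1 0 x), ex_RInt_cont, Hf.
    - apply RInt_ext; intros y _. rewrite Hp. unfold scal; simpl; unfold mult; simpl.
      now rewrite !Rmult_1_l. }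
  rewrite <- (RInt_Chasles f 0 1 (x + 1)) by (apply ex_RInt_cont, Hf).
  rewrite Hshift. unfold plus; simpl. ring.
Qed.

Lemma drift_corrected_bounded (f : R -> R) :
  (forall x, continuous f x) -> periodic1 f -> (forall x, 0 <= f x) ->
  forall x, Rabs (drift_corrected f x) <= RInt f 0 1.
Proof.
  intros Hf Hp Hpos.
  apply periodic1_bounded; [now apply drift_corrected_periodic|].
  intros x [H0 H1]. unfold drift_corrected.
  assert (A : 0 <= RInt f 0 x) by
    (apply RInt_ge_0; auto; now apply ex_RInt_cont).
  assert (B : 0 <= RInt f x 1) by
    (apply RInt_ge_0; auto; now apply ex_RInt_cont).
  assert (C : RInt f 0 x + RInt f x 1 = RInt f 0 1) by
    (apply (RInt_Chasles f 0 x 1); now apply ex_RInt_cont).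
  apply Rabs_le. nra.
Qed.

(** * Rescaled integrals *)

Lemma is_derive_rescaled_primitive (f : R -> R) (eps : R) (u : R -> R) (t du : R) :
  (forall x, continuous f x) -> 0 < eps -> is_derive u t du ->
  is_derive (fun s => eps * RInt f 0 (u s / eps)) t (f (u t / eps) * du).
Proof.
  intros Hf He Hu.
  replace (f (u t / eps) * du) with (eps * ((/ eps * du) * f (u t / eps)))
    by (field; lra).
  apply is_derive_scal.
  apply (is_derive_comp (fun y => RInt f 0 y) (fun s => u s / eps)).
  - now apply is_derive_primitive.
  - apply (is_derive_ext (fun s => / eps * u s)).
    + intros s; unfold Rdiv; apply Rmult_comm.
    + now apply is_derive_scal.
Qed.

Lemma continuous_rescaled (f : R -> R) (eps x : R) :
  (forall y, continuous f y) -> continuous (fun g => f (g / eps)) x.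
Proof.
  intros Hf. apply (continuous_comp (fun g => g / eps) f); [|apply Hf].
  apply (continuous_scal_l (fun g : R => g) (/ eps) x), continuous_id.
Qed.

Lemma RInt_rescaled (f : R -> R) (eps a b : R) :
  (forall x, continuous f x) -> 0 < eps ->
  RInt (fun g => f (g / eps)) a b
  = eps * RInt f 0 (b / eps) - eps * RInt f 0 (a / eps).
Proof.
  intros Hf He. apply is_RInt_unique.
  apply (is_RInt_derive (fun x => eps * RInt f 0 (x / eps))).
  - intros x _. rewrite <- (Rmult_1_r (f (x / eps))).
    apply (is_derive_rescaled_primitive f eps (fun s => s)); auto.
    apply (is_derive_id x).
  - intros x _. now apply continuous_rescaled.
Qed.

Lemma rescaled_integral_error (f : R -> R) (eps a b : R) :
  (forall x, continuous f x) -> periodic1 f -> (forall x, 0 <= f x) ->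
  0 < eps ->
  Rabs (RInt (fun g => f (g / eps)) a b - RInt f 0 1 * (b - a))
  <= 2 * eps * RInt f 0 1.
Proof.
  intros Hf Hp Hpos He.
  assert (Heq : RInt (fun g => f (g / eps)) a b - RInt f 0 1 * (b - a)
    = eps * (drift_corrected f (b / eps) - drift_corrected f (a / eps))).
  { rewrite RInt_rescaled by assumption. unfold drift_corrected. field. lra. }
  rewrite Heq, Rabs_mult, (Rabs_pos_eq eps) by lra.
  assert (Hb := drift_corrected_bounded f Hf Hp Hpos (b / eps)).
  assert (Ha := drift_corrected_bounded f Hf Hp Hpos (a / eps)).
  apply Rabs_le_between in Hb, Ha.
  replace (2 * eps * RInt f 0 1) with (eps * (2 * RInt f 0 1)) by ring.
  apply Rmult_le_compat_l; [lra|]. apply Rabs_le. lra.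
Qed.

(** * The inverse speed and the arrival time *)

(** Reciprocal of the speed of a particle of energy [E] at position [g] of the
    unit cell; [effective_sigma V E] is its mean. *)
Definition inverse_speed (V : R -> R) (E g : R) : R :=
  1 / sqrt (2 * (E - V g)).

Lemma inverse_speed_continuous (V : R -> R) (E : R) :
  (forall x, continuous V x) -> (forall x, V x < E) ->
  forall x, continuous (inverse_speed V E) x.
Proof.
  intros HV HE x. unfold inverse_speed.
  assert (Hp : 0 < 2 * (E - V x)) by (specialize (HE x); lra).
  apply (continuous_comp V (fun v => 1 / sqrt (2 * (E - v)))); [apply HV|].
  apply (ex_derive_continuous (fun v => 1 / sqrt (2 * (E - v)))).
  auto_derive. repeat split; auto.
  apply Rgt_not_eq, sqrt_lt_R0, Hp.
Qed.

Lemma inverse_speed_periodic (V : R -> R) (E : R) :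
  periodic1 V -> periodic1 (inverse_speed V E).
Proof. intros Hp x. unfold inverse_speed. now rewrite Hp. Qed.

Lemma inverse_speed_pos (V : R -> R) (E x : R) :
  V x < E -> 0 < inverse_speed V E x.
Proof.
  intros HE. apply Rdiv_lt_0_compat; [lra|]. apply sqrt_lt_R0. lra.
Qed.

(** Conservation of energy, solved for a positive velocity [v]. *)
Lemma inverse_speed_mult (V : R -> R) (E x v : R) :
  0 < v -> 1 / 2 * Rabs v ^ 2 + V x = E -> inverse_speed V E x * v = 1.
Proof.
  intros Hv HE. rewrite Rabs_pos_eq in HE by lra. unfold inverse_speed.
  replace (2 * (E - V x)) with (v * v) by (rewrite <- HE; field).
  rewrite sqrt_square by lra. field. lra.
Qed.

Lemma arrival_time_eq (V : R -> R) (E qa qb eps : R) (q : R -> R) (T : R) :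
  (forall x, continuous V x) -> (forall x, V x < E) -> 0 < eps ->
  is_trajectory V E qa qb eps q T -> T = t_eps V E qa eps qb.
Proof.
  intros HV HE He (Hd & _ & Hpos & H0 & HT & Hen).
  set (f := inverse_speed V E).
  assert (Hf : forall x, continuous f x) by now apply inverse_speed_continuous.
  change (t_eps V E qa eps qb) with (RInt (fun g => f (g / eps)) qa qb).
  rewrite RInt_rescaled, <- H0, <- HT by assumption.
  (* The sign of [T] is not needed: both integrals of the constant 1 over
     [0, T] are oriented. *)
  assert (H1 : is_RInt (fun _ => 1) 0 T
    (eps * RInt f 0 (q T / eps) - eps * RInt f 0 (q 0 / eps))).
  { apply (is_RInt_derive (fun s => eps * RInt f 0 (q s / eps))).
    - intros t _. rewrite <- (inverse_speed_mult V E (q t / eps) (Derive q t)) by auto.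
      apply is_derive_rescaled_primitive; auto. apply Derive_correct, Hd.
    - intros t _. apply continuous_const. }
  apply (is_RInt_unique (V := R_CompleteNormedModule)) in H1.
  rewrite RInt_const in H1. unfold scal in H1; simpl in H1.
  unfold mult in H1; simpl in H1. lra.
Qed.

(** * Convergence *)

Lemma at_right_0_linear (C r : R) :
  0 < r -> at_right 0 (fun eps => 0 < eps /\ C * eps < r).
Proof.
  intros Hr.
  assert (HC : 0 < Rabs C + 1) by (generalize (Rabs_pos C); lra).
  exists (mkposreal _ (Rdiv_lt_0_compat _ _ Hr HC)).
  intros eps Hb Hpos. split; [exact Hpos|].
  unfold ball in Hb; simpl in Hb; unfold AbsRing_ball, abs, minus, plus, opp in Hb.
  simpl in Hb.
  rewrite Ropp_0, Rplus_0_r, Rabs_pos_eq in Hb by lra.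
  apply (Rmult_lt_compat_r _ _ _ HC) in Hb.
  replace (r / (Rabs C + 1) * (Rabs C + 1)) with r in Hb by (field; lra).
  generalize (Rle_abs C); nra.
Qed.

Theorem theorem2p5 (V : R -> R) (E qa qb : R)
  (q : R -> R -> R) (T : R -> R)
  (hV : C2 V) (hper : periodic1 V) (hmax : is_max V 0)
  (hE : 0 < E) (hab : qa < qb)
  (hq : forall eps : R, 0 < eps -> is_trajectory V E qa qb eps (q eps) (T eps)) :
  cvg_uniformly_at_0 (t_eps V E qa) (t_bar V E qa) /\
  filterlim T (at_right 0) (locally (effective_sigma V E * (qb - qa))).
Proof.
  assert (HVc : forall x, continuous V x).
  { intros x. apply (ex_derive_continuous V). apply (proj1 hV 1%nat x). auto. }
  assert (HVE : forall x, V x < E).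
  { intros x. generalize (proj1 hmax x). lra. }
  assert (Herr : forall eps x, 0 < eps ->
    Rabs (t_eps V E qa eps x - t_bar V E qa x)
    <= 2 * effective_sigma V E * eps).
  { intros eps x He.
    replace (2 * effective_sigma V E * eps) with (2 * eps * effective_sigma V E)
      by ring.
    apply (rescaled_integral_error (inverse_speed V E)); auto.
    - now apply inverse_speed_continuous.
    - now apply inverse_speed_periodic.
    - intros y. now apply Rlt_le, inverse_speed_pos. }
  split.
  - intros P [r Hr].
    change (at_right 0 (fun eps => P (t_eps V E qa eps))).
    generalize (at_right_0_linear (2 * effective_sigma V E) r (cond_pos r)).
    apply filter_imp. intros eps [He Hs]. apply Hr. intros x.
    apply Rle_lt_trans with (2 := Hs). now apply Herr.
  - intros P [r Hr].
    change (at_right 0 (fun eps => P (T eps))).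
    generalize (at_right_0_linear (2 * effective_sigma V E) r (cond_pos r)).
    apply filter_imp. intros eps [He Hs]. apply Hr.
    apply Rle_lt_trans with (2 := Hs).
    rewrite (arrival_time_eq V E qa qb eps (q eps) (T eps)) by auto.
    now apply Herr.
Qed.
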